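(* Let $H\subset\mathbb{R}^n$ be a Hanner polytope with polar $H^\circ$. Then any simple classical closed billiard trajectory in $H$ with geometry specified by $H^\circ$, with bounce points $q_i$ and momenta $p_i$: (1) has length $4$, lengths being measured in the norm with unit ball $H$; (2) is $2n$-periodic (bounces exactly $2n$ times); (3) is centrally symmetric with respect to the origin, i.e. $q_{i+n}=-q_i$ for all $i$, and the corresponding momentum trajectory is also centrally symmetric with respect to the origin, i.e. $p_{i+n}=-p_i$ for all $i$ (indices modulo $2n$).
   Context: Hanner polytopes. If $K\subset\mathbb{R}^k$, $L\subset\mathbb{R}^l$ are unit balls of norms $\|\cdot\|^{(1)},\|\cdot\|^{(2)}$, then $K\oplus_1L\subset\mathbb{R}^{k+l}$ is the unit ball of the norm $\|x\|^{(1)}+\|y\|^{(2)}$, and $K\oplus_\infty L\subset\mathbb{R}^{k+l}$ is the unit ball of $\max\{\|x\|^{(1)},\|y\|^{(2)}\}$, for $(x,y)\in\mathbb{R}^k\oplus\mathbb{R}^l$. Hanner polytopes are the bodies obtained inductively: $[-1,1]\subset\mathbb{R}^1$ is a Hanner polytope, and if $K,L$ are Hanner polytopes, so are $K\oplus_1L$ and $K\oplus_\infty L$. Classical billiard trajectories. Let $V=\mathbb{R}^n$ with dual $V^*$, and let $K\subset V$, $T\subset V^*$ be convex polytopes containing the origin in their interiors. For $q$ in the relative interior of a facet of $K$ (the smooth part of $\partial K$), $n_K(q)\in V^*$ is the outer normal given by the differential at $q$ of the gauge function of $K$ (the norm with unit ball $K$); similarly $n_T(p)\in V$ for $p$ in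 the relative interior of a facet of $T$. A classical closed billiard trajectory in $K$ with geometry specified by $T$ (in the configuration $K\times T$) is a cyclic sequence of bounce points $q_1,\dots,q_m$ and momenta $p_1,\dots,p_m$ (indices modulo $m$), each $q_i$ in the relative interior of a facet of $K$ and each $p_i$ in the relative interior of a facet of $T$, such that for all $i$ $$p_{i+1}-p_i=-\lambda_i\, n_K(q_i),\qquad q_{i+1}-q_i=\mu_i\, n_T(p_{i+1}),\qquad \lambda_i,\mu_i>0.$$ It is then called $m$-periodic. (For $n=1$, facets are the two end points, which count as their own relative interiors.) Its length is $\sum_{i=1}^m\|q_{i+1}-q_i\|_T$, where $\|q\|_T=\max_{p\in T}\langle p,q\rangle$. It is simple if it does not traverse the same closed route several times, i.e. the cyclic sequence $((q_i,p_i))_i$ is not a repetition, two or more times, of a shorter one. *)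

(* Defs.v *)
From HB Require Import structures.
From mathcomp Require Import all_boot all_order all_algebra.
From mathcomp Require Import all_classical all_reals all_analysis.
Set Implicit Arguments.
Unset Strict Implicit.
Unset Printing Implicit Defensive.
Import Order.TTheory GRing.Theory Num.Theory.
Import numFieldNormedType.Exports.

Local Open Scope classical_set_scope.
Local Open Scope ring_scope.

(* Both V = R^n and its dual V^* are represented by row vectors; a covector p
   acts on a vector q by pairing p q. *)
Definition pairing (R : realType) (n : nat) (p q : 'rV[R]_n) : R :=
  \sum_(i < n) p 0 i * q 0 i.

(* The norm with unit ball K, when K is the unit ball of a norm. *)
Definition gauge (R : realType) (n : nat) (K : set 'rV[R]_n) (x : 'rV[R]_n) : R :=
  inf [set r : R | 0 < r /\ K (r^-1 *: x)].

Definition polar (R : realType) (n : nat) (K : set 'rV[R]_n) : set 'rV[R]_n :=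
  [set p | forall q, K q -> pairing p q <= 1].

Definition sum_one (R : realType) (k l : nat)
    (K : set 'rV[R]_k) (L : set 'rV[R]_l) : set 'rV[R]_(k + l) :=
  [set z | gauge K (lsubmx z) + gauge L (rsubmx z) <= 1].

Definition sum_infty (R : realType) (k l : nat)
    (K : set 'rV[R]_k) (L : set 'rV[R]_l) : set 'rV[R]_(k + l) :=
  [set z | Num.max (gauge K (lsubmx z)) (gauge L (rsubmx z)) <= 1].

Inductive hanner (R : realType) : forall n : nat, set 'rV[R]_n -> Prop :=
| hanner_segment : hanner [set x : 'rV[R]_1 | -1 <= x 0 0 <= 1]
| hanner_sum_one (k l : nat) (K : set 'rV[R]_k) (L : set 'rV[R]_l) :
    hanner K -> hanner L -> hanner (sum_one K L)
| hanner_sum_infty (k l : nat) (K : set 'rV[R]_k) (L : set 'rV[R]_l) :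
    hanner K -> hanner L -> hanner (sum_infty K L).

Definition affine_hull (R : realType) (n : nat) (F : set 'rV[R]_n) :
    set 'rV[R]_n :=
  [set x | exists (k : nat) (a : 'I_k -> R) (v : 'I_k -> 'rV[R]_n),
     [/\ forall i, F (v i), \sum_(i < k) a i = 1
       & x = \sum_(i < k) a i *: v i]].

(* The affine hull of F is a translate of the d-dimensional row space of M. *)
Definition affine_dim (R : realType) (n : nat) (F : set 'rV[R]_n) (d : nat) :
    Prop :=
  exists (x0 : 'rV[R]_n) (M : 'M[R]_(d, n)),
    row_free M /\ affine_hull F = [set x | (x - x0 <= M)%MS].

Definition relative_interior (R : realType) (n : nat) (F : set 'rV[R]_n) :
    set 'rV[R]_n :=
  [set x | F x /\ \forall y \near x, affine_hull F y -> F y].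

Definition face (R : realType) (n : nat) (K F : set 'rV[R]_n) : Prop :=
  exists (a : 'rV[R]_n) (c : R),
    (forall x, K x -> pairing a x <= c) /\
    F = K `&` [set x | pairing a x = c].

Definition facet (R : realType) (n : nat) (K F : set 'rV[R]_n) : Prop :=
  face K F /\ affine_dim F n.-1.

Definition in_facet_interior (R : realType) (n : nat) (K : set 'rV[R]_n)
    (x : 'rV[R]_n) : Prop :=
  exists2 F : set 'rV[R]_n, facet K F & relative_interior F x.

(* The covector representing the differential of gauge K at q. *)
Definition outer_normal (R : realType) (n : nat) (K : set 'rV[R]_n)
    (q : 'rV[R]_n) : 'rV[R]_n :=
  \row_(i < n) 'd (gauge K) q (delta_mx 0 i).

(* ordS is the cyclic successor on 'I_m. *)
Definition billiard_trajectory (R : realType) (n : nat) (K T : set 'rV[R]_n)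
    (m : nat) (q p : 'I_m -> 'rV[R]_n) : Prop :=
  [/\ (0 < m)%N,
      forall i, in_facet_interior K (q i),
      forall i, in_facet_interior T (p i),
      forall i, exists2 lambda : R, 0 < lambda &
        p (ordS i) - p i = - (lambda *: outer_normal K (q i)) &
      forall i, exists2 mu : R, 0 < mu &
        q (ordS i) - q i = mu *: outer_normal T (p (ordS i))].

Definition simple_trajectory (R : realType) (n m : nat)
    (q p : 'I_m -> 'rV[R]_n) : Prop :=
  ~ exists k d : nat, [/\ (1 < k)%N, m = (k * d)%N &
      forall i j : 'I_m, i = j %[mod d] -> q i = q j /\ p i = p j].

(* max_(p in T) <p, x> *)
Definition support_norm (R : realType) (n : nat) (T : set 'rV[R]_n)
    (x : 'rV[R]_n) : R :=
  sup [set pairing p x | p in T].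

Definition length_wrt (R : realType) (n : nat) (N : 'rV[R]_n -> R)
    (m : nat) (q : 'I_m -> 'rV[R]_n) : R :=
  \sum_(i < m) N (q (ordS i) - q i).

(* Main.v *)
(* Let N and M be the norms with unit balls H and its polar. If H is an infinity-sum,
   N = max(N1, N2) and M = M1 + M2, write q = (x, y) and p = (a, b). At a bounce only
   one of x, y is on its boundary, so only one of a, b changes, and since
   M1(a) + M2(b) = 1 both M1(a) and M2(b) are conserved. Hence x with a / M1(a), and
   y with b / M2(b), run through billiard trajectories of the two factors, both with
   unit speed in the common flight time. If each of them is negated after time 2, so
   is the whole trajectory, and the bounces made in that time add up. A 1-sum is
   reduced to an infinity-sum by exchanging bounce points and momenta, (q, p)
   becoming (p, - q). This also exchanges the lengths of the q- and p-trajectories,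
   which agree over a half period by summation by parts. *)
Require Import Defs.
From HB Require Import structures.
From mathcomp Require Import all_boot all_order all_algebra.
From mathcomp Require Import all_classical all_reals all_analysis.
From mathcomp Require Import ring lra zify.
Set Implicit Arguments.
Unset Strict Implicit.
Unset Printing Implicit Defensive.
Import Order.TTheory GRing.Theory Num.Theory.
Import numFieldNormedType.Exports.
Local Open Scope classical_set_scope.
Local Open Scope ring_scope.

(** * Pairs of polar norms *)

Lemma pairingC (R : realType) n (p q : 'rV[R]_n) : pairing p q = pairing q p.
Proof. by apply: eq_bigr => i _; rewrite mulrC. Qed.

Lemma pairingDr (R : realType) n (p q r : 'rV[R]_n) :
  pairing p (q + r) = pairing p q + pairing p r.
Proof. by rewrite -big_split; apply: eq_bigr => i _; rewrite mxE mulrDr. Qed.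

Lemma pairingZr (R : realType) n (p q : 'rV[R]_n) (t : R) :
  pairing p (t *: q) = t * pairing p q.
Proof. by rewrite mulr_sumr; apply: eq_bigr => i _; rewrite mxE mulrCA. Qed.

Lemma pairingNr (R : realType) n (p q : 'rV[R]_n) :
  pairing p (- q) = - pairing p q.
Proof. by rewrite -scaleN1r pairingZr mulN1r. Qed.

Lemma pairing0r (R : realType) n (p : 'rV[R]_n) : pairing p 0 = 0.
Proof. by rewrite -(scale0r 0) pairingZr mul0r. Qed.

Lemma pairingDl (R : realType) n (p q r : 'rV[R]_n) :
  pairing (p + q) r = pairing p r + pairing q r.
Proof. by rewrite pairingC pairingDr !(pairingC r). Qed.

Lemma pairingZl (R : realType) n (p q : 'rV[R]_n) (t : R) :
  pairing (t *: p) q = t * pairing p q.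
Proof. by rewrite pairingC pairingZr pairingC. Qed.

Lemma pairingNl (R : realType) n (p q : 'rV[R]_n) :
  pairing (- p) q = - pairing p q.
Proof. by rewrite pairingC pairingNr pairingC. Qed.

Lemma pairing0l (R : realType) n (p : 'rV[R]_n) : pairing 0 p = 0.
Proof. by rewrite pairingC pairing0r. Qed.

Lemma pairing_split (R : realType) k l (p q : 'rV[R]_(k + l)) :
  pairing p q = pairing (lsubmx p) (lsubmx q) + pairing (rsubmx p) (rsubmx q).
Proof.
rewrite /pairing big_split_ord /=.
by congr (_ + _); apply: eq_bigr => i _; rewrite !mxE.
Qed.

Lemma pairing_row (R : realType) k l (x a : 'rV[R]_k) (y b : 'rV[R]_l) :
  pairing (row_mx a b) (row_mx x y) = pairing a x + pairing b y.
Proof. by rewrite pairing_split !row_mxKl !row_mxKr. Qed.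

Lemma pairing_self_eq0 (R : realType) n (p : 'rV[R]_n) : pairing p p = 0 -> p = 0.
Proof.
move=> p0; apply/rowP => i; rewrite mxE.
have := p0; rewrite /pairing => /psumr_eq0P H.
by apply/eqP; rewrite -sqrf_eq0 expr2 H // => j _; rewrite -expr2 sqr_ge0.
Qed.

Lemma pairing_delta (R : realType) n (p : 'rV[R]_n) i :
  pairing p (delta_mx 0 i) = p 0 i.
Proof.
rewrite /pairing (bigD1 i) //= mxE !eqxx mulr1 big1 ?addr0 // => j ji.
by rewrite mxE eqxx (negbTE ji) mulr0.
Qed.

Record is_norm (R : realType) n (N : 'rV[R]_n -> R) : Prop := IsNorm {
  normZ : forall t x, N (t *: x) = `|t| * N x;
  norm_triangle : forall x y, N (x + y) <= N x + N y }.

Section NormTheory.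
Variables (R : realType) (n : nat) (N : 'rV[R]_n -> R).
Hypothesis nN : is_norm N.

Lemma norm_zero : N 0 = 0.
Proof. by rewrite -(scale0r 0) (normZ nN) normr0 mul0r. Qed.

Lemma norm_opp x : N (- x) = N x.
Proof. by rewrite -scaleN1r (normZ nN) normrN1 mul1r. Qed.

Lemma norm_ge0 x : 0 <= N x.
Proof.
have := norm_triangle nN x (- x).
rewrite subrr norm_zero norm_opp; lra.
Qed.

Lemma norm_add_ge x h : N x - N h <= N (x + h).
Proof. by have := norm_triangle nN (x + h) (- h); rewrite addrK norm_opp; lra. Qed.

End NormTheory.

(** Duality is expressed by inequalities only, so that no maximum has to be attained, and in a form
    symmetric in [N] and [M]. Positive dimension rules out the zero space, where the zero norm is
    linear near 0. *)
Record polar_pair (R : realType) n (N M : 'rV[R]_n -> R) : Prop := PolarPair {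
  polar_pair_dim : (0 < n)%N;
  polar_pair_norm : is_norm N;
  polar_pair_dual : is_norm M;
  polar_pair_holder : forall a x, pairing a x <= M a * N x;
  polar_pair_dual_le : forall a s,
    (forall x, N x <= 1 -> pairing a x <= s) -> M a <= s;
  polar_pair_norm_le : forall x s,
    (forall a, M a <= 1 -> pairing a x <= s) -> N x <= s }.

Lemma polar_pairC (R : realType) n (N M : 'rV[R]_n -> R) :
  polar_pair N M -> polar_pair M N.
Proof.
case=> n0 nN nM hol dM dN; split => // [a x|x s H|a s H].
- by rewrite pairingC mulrC.
- by apply: dN => a /H; rewrite pairingC.
- by apply: dM => x /H; rewrite pairingC.
Qed.

Definition segment_norm (R : realType) (x : 'rV[R]_1) : R := `|x 0 0|.

Definition add_norm (R : realType) k l (N1 : 'rV[R]_k -> R) (N2 : 'rV[R]_l -> R)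
  (z : 'rV[R]_(k + l)) : R := N1 (lsubmx z) + N2 (rsubmx z).

Definition max_norm (R : realType) k l (N1 : 'rV[R]_k -> R) (N2 : 'rV[R]_l -> R)
  (z : 'rV[R]_(k + l)) : R := Num.max (N1 (lsubmx z)) (N2 (rsubmx z)).

Lemma polar_pair_segment (R : realType) :
  polar_pair (@segment_norm R) (@segment_norm R).
Proof.
have nS : is_norm (@segment_norm R).
  split => [t x|x y]; rewrite /segment_norm mxE ?normrM //.
  exact: ler_normD.
have pE (a x : 'rV[R]_1) : pairing a x = a 0 0 * x 0 0 by rewrite /pairing big_ord1.
have le a s : (forall x : 'rV[R]_1, segment_norm x <= 1 -> pairing a x <= s) ->
    segment_norm a <= s.
  move=> /(_ (const_mx (Num.sg (a 0 0)))).
  rewrite /segment_norm pE mxE mulrC -normrEsg; apply.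
  by rewrite normr_sg; case: (_ == _).
split=> // [a x|x s H].
  by rewrite pE /segment_norm -normrM ler_norm.
by apply: le => a /H; rewrite pairingC.
Qed.

Lemma polar_pair_add (R : realType) k l (N1 M1 : 'rV[R]_k -> R)
    (N2 M2 : 'rV[R]_l -> R) :
  polar_pair N1 M1 -> polar_pair N2 M2 ->
  polar_pair (add_norm N1 N2) (max_norm M1 M2).
Proof.
move=> H1 H2.
have nN1 := polar_pair_norm H1; have nN2 := polar_pair_norm H2.
have nM1 := polar_pair_dual H1; have nM2 := polar_pair_dual H2.
split.
- by rewrite addn_gt0 (polar_pair_dim H1).
- split=> [t x|x y]; rewrite /add_norm.
    by rewrite !linearZ /= (normZ nN1) (normZ nN2) mulrDr.
  rewrite !linearD /= addrACA.
  by rewrite lerD ?(norm_triangle nN1) ?(norm_triangle nN2).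
- split=> [t x|x y]; rewrite /max_norm.
    by rewrite !linearZ /= (normZ nM1) (normZ nM2) maxr_pMr.
  rewrite !linearD /= ge_max.
  apply/andP; split.
    apply: (le_trans (norm_triangle nM1 _ _)).
    by rewrite lerD // le_max lexx.
  apply: (le_trans (norm_triangle nM2 _ _)).
  by rewrite lerD // le_max lexx orbT.
- move=> a x; rewrite pairing_split /max_norm /add_norm mulrDr.
  apply: lerD.
    apply: (le_trans (polar_pair_holder H1 _ _)).
    by rewrite ler_wpM2r ?(norm_ge0 nN1) // le_max lexx.
  apply: (le_trans (polar_pair_holder H2 _ _)).
  by rewrite ler_wpM2r ?(norm_ge0 nN2) // le_max lexx orbT.
- move=> a s H; rewrite /max_norm ge_max; apply/andP; split.
    apply: (polar_pair_dual_le H1) => x Nx.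
    have := H (row_mx x 0); rewrite /add_norm row_mxKl row_mxKr.
    rewrite (norm_zero nN2) addr0 => /(_ Nx).
    by rewrite pairing_split row_mxKl row_mxKr pairing0r addr0.
  apply: (polar_pair_dual_le H2) => x Nx.
  have := H (row_mx 0 x); rewrite /add_norm row_mxKl row_mxKr.
  rewrite (norm_zero nN1) add0r => /(_ Nx).
  by rewrite pairing_split row_mxKl row_mxKr pairing0r add0r.
(* The supremum over pairs [(a, b)] is taken one block at a time, the other block being moved to the
   right-hand side. *)
- move=> z s H; rewrite /add_norm -lerBrDr.
  apply: (polar_pair_norm_le H1) => a Ma.
  rewrite lerBrDl -lerBrDr.
  apply: (polar_pair_norm_le H2) => b Mb.
  rewrite lerBrDl addrC.
  have := H (row_mx a b); rewrite /max_norm row_mxKl row_mxKr ge_max Ma Mb => /(_ isT).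
  by rewrite pairing_split row_mxKl row_mxKr addrC.
Qed.

(* The neighbourhood of q is measured by N itself, so that it splits along sums and
   maxima of norms; for a polytope norm this says that q is, up to scaling, in the
   interior of the facet with outer normal v. *)
Definition linear_near (R : realType) n (N : 'rV[R]_n -> R) (q v : 'rV[R]_n) :=
  exists2 e : R, 0 < e & forall h, N h < e -> N (q + h) = pairing v (q + h).

Section LinearNear.
Variables (R : realType) (n : nat) (N : 'rV[R]_n -> R).
Hypothesis nN : is_norm N.

Lemma linear_near_eq q v : linear_near N q v -> N q = pairing v q.
Proof.
by case=> e e0 /(_ 0); rewrite addr0 (norm_zero nN); apply.
Qed.

Lemma norm_scale_lt e x : 0 < e -> exists2 t : R, 0 < t & N (t *: x) < e.
Proof.
(* The added 1 keeps the denominator positive when [N x = 0]. *)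
move=> e0; exists (e / (2 * (N x + 1))); have Nx := norm_ge0 nN x.
  by rewrite divr_gt0 //; lra.
rewrite (normZ nN) ger0_norm; last by rewrite divr_ge0 //; lra.
rewrite mulrAC ltr_pdivrMr; last by lra.
nra.
Qed.

(** Both forms agree at [q] and at [q + t *: (v - w)] for a small [t], so [v - w] is orthogonal to
    itself. *)
Lemma linear_near_unique q v w :
  linear_near N q v -> linear_near N q w -> v = w.
Proof.
move=> Hv Hw; have := linear_near_eq Hw; rewrite (linear_near_eq Hv) => E.
case: Hv Hw => [e e0 He] [f f0 Hf].
have ef : 0 < Num.min e f by rewrite lt_min e0.
have [t t0] := norm_scale_lt (v - w) ef; rewrite lt_min => /andP[te tf].
have := He _ te; rewrite (Hf _ tf) !pairingDr E !pairingZr => /addrI.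
move=> /(mulfI (lt0r_neq0 t0)) /eqP; rewrite -subr_eq0 -pairingNl -pairingDl.
rewrite -[X in pairing X _]opprB pairingNl oppr_eq0 => /eqP /pairing_self_eq0.
by move=> /eqP; rewrite subr_eq0 => /eqP.
Qed.

Lemma linear_near_scale q v t : 0 < t ->
  linear_near N q v -> linear_near N (t *: q) v.
Proof.
move=> t0 [e e0 He]; exists (t * e); first by rewrite mulr_gt0.
move=> h hlt; have -> : t *: q + h = t *: (q + t^-1 *: h).
  by rewrite scalerDr scalerA divff ?lt0r_neq0 // scale1r.
rewrite (normZ nN) gtr0_norm // pairingZr He //.
by rewrite (normZ nN) gtr0_norm ?invr_gt0 // mulrC ltr_pdivrMr // mulrC.
Qed.

Lemma linear_near_opp q v : linear_near N q v -> linear_near N (- q) (- v).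
Proof.
move=> [e e0 He]; exists e => // h hlt.
have -> : - q + h = - (q - h) by rewrite opprB addrC.
by rewrite (norm_opp nN) pairingNl pairingNr opprK He // (norm_opp nN).
Qed.

(** The vector [v] is a subgradient at [q]: for a small step in the direction [x], the triangle
    inequality compares the increment of the linear form with the norm of the step. *)
Lemma linear_near_le q v x : linear_near N q v -> pairing v x <= N x.
Proof.
move=> Hv; have E := linear_near_eq Hv; case: Hv => e e0 He.
have [t t0 te] := norm_scale_lt x e0.
have := norm_triangle nN q (t *: x).
rewrite He // pairingDr -E lerD2l pairingZr (normZ nN) gtr0_norm //.
by rewrite ler_pM2l.
Qed.

End LinearNear.

Section PolarPair.
Variables (R : realType) (n : nat) (N M : 'rV[R]_n -> R).
Hypothesis PP : polar_pair N M.

Lemma polar_pair_eq0 x : N x = 0 -> x = 0.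
Proof.
move=> x0; apply: pairing_self_eq0; apply/eqP; rewrite eq_le.
have := polar_pair_holder PP x x; rewrite x0 mulr0 => -> /=.
by apply: sumr_ge0 => i _; rewrite -expr2 sqr_ge0.
Qed.

(** At [q = 0] symmetry would make both [v] and [- v] represent [N]. Then [v = 0], and [N] would
    vanish on a small multiple of the all-ones vector. *)
Lemma linear_near_gt0 q v : linear_near N q v -> 0 < N q.
Proof.
have nN := polar_pair_norm PP.
move=> Hv; rewrite lt0r (norm_ge0 nN) andbT; apply/eqP => /polar_pair_eq0 q0.
have := linear_near_opp nN Hv; rewrite q0 oppr0 => Hv'.
rewrite q0 in Hv; have vE := linear_near_unique nN Hv Hv'.
have v0 : v = 0.
  apply/rowP => i; have := congr1 (fun x : 'rV_n => x 0 i) vE; rewrite !mxE; lra.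
case: Hv => e e0 He.
have [t t0 te] := norm_scale_lt nN (const_mx 1) e0.
have := He _ te; rewrite v0 pairing0l add0r => /polar_pair_eq0 E.
have := congr1 (fun x : 'rV_n => x 0 (Ordinal (polar_pair_dim PP))) E.
rewrite !mxE mulr1; lra.
Qed.

(** The subgradient inequality gives one bound, the Hölder inequality at [q] the other. Applied to
    momenta, this says that flights have unit speed. *)
Lemma linear_near_dual_eq1 q v : linear_near N q v -> M v = 1.
Proof.
have nN := polar_pair_norm PP.
move=> Hv; have q0 := linear_near_gt0 Hv.
apply/eqP; rewrite eq_le; apply/andP; split.
  apply: (polar_pair_dual_le PP) => x; apply: le_trans.
  exact: (linear_near_le nN _ Hv).
have := polar_pair_holder PP v q; rewrite -(linear_near_eq nN Hv).
by rewrite -{1}[N q]mul1r ler_pM2r.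
Qed.

End PolarPair.

Lemma linear_near_add (R : realType) k l (N1 : 'rV[R]_k -> R)
    (N2 : 'rV[R]_l -> R) q v :
  is_norm N1 -> is_norm N2 -> linear_near (add_norm N1 N2) q v ->
  linear_near N1 (lsubmx q) (lsubmx v) /\ linear_near N2 (rsubmx q) (rsubmx v).
Proof.
move=> n1 n2 [e e0 He].
have E1 h : N1 h < e -> N1 (lsubmx q + h) + N2 (rsubmx q) =
    pairing (lsubmx v) (lsubmx q + h) + pairing (rsubmx v) (rsubmx q).
  move=> hlt; have := He (row_mx h 0).
  rewrite /add_norm pairing_split !linearD /= !row_mxKl !row_mxKr.
  by rewrite (norm_zero n2) !addr0; apply.
have E2 h : N2 h < e -> N1 (lsubmx q) + N2 (rsubmx q + h) =
    pairing (lsubmx v) (lsubmx q) + pairing (rsubmx v) (rsubmx q + h).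
  move=> hlt; have := He (row_mx 0 h).
  rewrite /add_norm pairing_split !linearD /= !row_mxKl !row_mxKr.
  by rewrite (norm_zero n1) !addr0 add0r; apply.
(* Moving one block only shows that the sum of the two norms is linear. A radial move of the first
   block separates the summands, since [N1] is homogeneous. *)
have E : N1 (lsubmx q) = pairing (lsubmx v) (lsubmx q).
  have [t t0 tlt] := norm_scale_lt n1 (lsubmx q) e0.
  have := E1 _ tlt; have := E1 0; rewrite (norm_zero n1) => /(_ e0).
  have -> : lsubmx q + t *: lsubmx q = (1 + t) *: lsubmx q.
    by rewrite scalerDl scale1r.
  rewrite (normZ n1) addr0 pairingZr gtr0_norm; last by lra.
  by nra.
have E' : N2 (rsubmx q) = pairing (rsubmx v) (rsubmx q).
  by have := E1 0; rewrite (norm_zero n1) addr0 E => /(_ e0) /addrI.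
split; exists e => // h hlt.
  by have := E1 h hlt; rewrite E' => /addIr.
by have := E2 h hlt; rewrite E => /addrI.
Qed.

Lemma max_normC_row (R : realType) k l (N1 : 'rV[R]_k -> R)
    (N2 : 'rV[R]_l -> R) x y :
  max_norm N1 N2 (row_mx x y) = max_norm N2 N1 (row_mx y x).
Proof. by rewrite /max_norm !row_mxKl !row_mxKr maxC. Qed.

(** At a tie, scaling one block by [1 + t] and the other by [1 - t] multiplies the maximum by
    [1 + |t|]. This is a kink at [t = 0], which a linear function cannot have. *)
Lemma linear_near_max_neq (R : realType) k l (N1 M1 : 'rV[R]_k -> R)
    (N2 M2 : 'rV[R]_l -> R) q v :
  polar_pair N1 M1 -> polar_pair N2 M2 -> linear_near (max_norm N1 N2) q v ->
  N1 (lsubmx q) <> N2 (rsubmx q).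
Proof.
move=> P1 P2 H Eq.
have PP := polar_pairC (polar_pair_add (polar_pairC P1) (polar_pairC P2)).
have q0 := linear_near_gt0 PP H.
have nN := polar_pair_norm PP.
have n1 := polar_pair_norm P1; have n2 := polar_pair_norm P2.
have E := linear_near_eq nN H.
case: H => e e0 He.
have c0 : 0 < N1 (lsubmx q) by move: q0; rewrite /max_norm -Eq maxxx.
have F t : `|t| < 1 -> `|t| * N1 (lsubmx q) < e ->
    (1 + `|t|) * N1 (lsubmx q) = (1 + t) * pairing (lsubmx v) (lsubmx q) +
      (1 - t) * pairing (rsubmx v) (rsubmx q).
  move=> t1 te; have := He (row_mx (t *: lsubmx q) ((- t) *: rsubmx q)).
  rewrite /max_norm pairing_split !linearD /= !row_mxKl !row_mxKr.
  rewrite (normZ n1) (normZ n2) normrN -Eq maxxx => /(_ te).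
  have sc m (x : 'rV[R]_m) s : x + s *: x = (1 + s) *: x.
    by rewrite scalerDl scale1r.
  rewrite !sc (normZ n1) (normZ n2) !pairingZr -Eq => <-.
  rewrite -maxr_pMl ?ltW //; congr (_ * _).
  have [t0|t0] := leP 0 t.
    have t1' : t < 1 by rewrite ger0_norm in t1.
    rewrite !ger0_norm; [|lra..]; rewrite max_l //; lra.
  have t1' : - t < 1 by rewrite ltr0_norm in t1.
  rewrite ltr0_norm // !ger0_norm; [|lra..]; rewrite max_r //; lra.
have [t t0 te] := norm_scale_lt n1 (lsubmx q) e0.
rewrite (normZ n1) gtr0_norm // in te.
(* The cap 1/2 keeps both factors [1 + s] and [1 - s] positive. *)
pose s := Num.min t (1/2).
have s0 : 0 < s by rewrite lt_min t0; lra.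
have s1 : s < 1 by rewrite gt_min; apply/orP; right; lra.
have se : s * N1 (lsubmx q) < e.
  apply: le_lt_trans te; rewrite ler_pM2r // /s ge_min lexx //.
have := F s; rewrite gtr0_norm // => /(_ s1 se).
have := F (- s); rewrite normrN gtr0_norm // => /(_ s1 se).
move: E; rewrite pairing_split /max_norm -Eq maxxx.
nra.
Qed.

(** Near [q] the first block alone decides the maximum, so moving the second block along [rsubmx v]
    changes nothing, and [rsubmx v] is orthogonal to itself. *)
Lemma linear_near_max_l (R : realType) k l (N1 : 'rV[R]_k -> R)
    (N2 : 'rV[R]_l -> R) q v :
  is_norm N1 -> is_norm N2 -> linear_near (max_norm N1 N2) q v ->
  N2 (rsubmx q) < N1 (lsubmx q) ->
  linear_near N1 (lsubmx q) (lsubmx v) /\ rsubmx v = 0.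
Proof.
move=> n1 n2 [e e0 He] lt.
(* If each block moves by less than half the gap, the order of the two norms is preserved. *)
pose g := (N1 (lsubmx q) - N2 (rsubmx q)) / 2.
pose d := Num.min e g.
have d0 : 0 < d by rewrite lt_min e0 divr_gt0 // subr_gt0.
have E h1 h2 : N1 h1 < d -> N2 h2 < d -> N1 (lsubmx q + h1) =
   pairing (lsubmx v) (lsubmx q + h1) + pairing (rsubmx v) (rsubmx q + h2).
  rewrite !lt_min => /andP[a1 b1] /andP[a2 b2].
  have := He (row_mx h1 h2).
  rewrite /max_norm pairing_split !linearD /= !row_mxKl !row_mxKr.
  rewrite gt_max a1 a2 => /(_ isT) <-; rewrite max_l //.
  have := norm_triangle n2 (rsubmx q) h2.
  have := norm_add_ge n1 (lsubmx q) h1.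
  rewrite /g in b1 b2; lra.
have v0 : rsubmx v = 0.
  apply: pairing_self_eq0.
  have [t t0 te] := norm_scale_lt n2 (rsubmx v) d0.
  have := E 0 (t *: rsubmx v); have := E 0 0.
  rewrite (norm_zero n1) (norm_zero n2) => /(_ d0 d0) + /(_ d0 te).
  rewrite !addr0 => -> /addrI; rewrite pairingDr -[X in X = _ -> _]addr0.
  move=> /addrI /esym /eqP; rewrite pairingZr mulf_eq0 (gt_eqF t0) /=.
  by move=> /eqP.
split=> //; exists d => // h hlt.
by rewrite (E h 0) ?(norm_zero n2) // v0 pairing0l addr0.
Qed.

(** * Trajectories *)

Record trajectory (R : realType) n (N M : 'rV[R]_n -> R)
    (q p : nat -> 'rV[R]_n) (lam mu : nat -> R) : Prop := Trajectory {
  trajectory_lam_gt0 : forall i, 0 < lam i;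
  trajectory_mu_gt0 : forall i, 0 < mu i;
  trajectory_q_norm : forall i, N (q i) = 1;
  trajectory_p_norm : forall i, M (p i) = 1;
  trajectory_bounce : forall i,
    exists2 v, linear_near N (q i) v & p i.+1 = p i - lam i *: v;
  trajectory_flight : forall i,
    exists2 w, linear_near M (p i.+1) w & q i.+1 = q i + mu i *: w }.

Definition bounce_time (R : realType) (mu : nat -> R) (i : nat) : R := \sum_(j < i) mu j.

Lemma bounce_timeS (R : realType) (mu : nat -> R) i :
  bounce_time mu i.+1 = bounce_time mu i + mu i.
Proof. exact: big_ord_recr. Qed.

Lemma bounce_time_le (R : realType) (mu : nat -> R) : (forall i, 0 < mu i) ->
  forall i j, (bounce_time mu i <= bounce_time mu j) = (i <= j)%N.
Proof.
move=> mu0; apply: Order.NatMonotonyTheory.incnP => i.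
by rewrite bounce_timeS ltrDl.
Qed.

Lemma bounce_time_lt (R : realType) (mu : nat -> R) : (forall i, 0 < mu i) ->
  forall i j, (bounce_time mu i < bounce_time mu j) = (i < j)%N.
Proof. by move=> mu0 i j; rewrite ltNge bounce_time_le // -ltnNge. Qed.

(** The clause on time belongs to the induction: unlike the number of bounces, the flight time is
    common to both factors of a sum and synchronizes them. *)
Definition half_period (R : realType) n (q p : nat -> 'rV[R]_n) (mu : nat -> R) :=
  exists i0, forall i, (i0 <= i)%N ->
    [/\ q (i + n)%N = - q i, p (i + n)%N = - p i &
        bounce_time mu (i + n) = bounce_time mu i + 2].

Definition periodic_from (R : realType) n (q p : nat -> 'rV[R]_n) (d i1 : nat) :=
  forall i, (i1 <= i)%N -> q (i + d)%N = q i /\ p (i + d)%N = p i.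

(* Trajectories are indexed by nat, not cyclically, so that subsequences of bounces
   can be taken; the start may be cut off, hence half_period holds from some index on. *)
Definition rotates (R : realType) n (N M : 'rV[R]_n -> R) :=
  forall q p lam mu, trajectory N M q p lam mu ->
    half_period q p mu /\
    (forall d i1, (0 < d)%N -> periodic_from q p d i1 -> (2 * n <= d)%N).

(** In dimension one the normal at an end point is that point itself. Positivity of [lam] and [mu]
    then forces alternation between the end points, each flight lasting 2. *)
Lemma rotates_segment (R : realType) :
  rotates (@segment_norm R) (@segment_norm R).
Proof.
move=> q p lam mu [lam0 mu0 q1 p1 bounce flight].
have nS := polar_pair_norm (polar_pair_segment R).
have pE (a x : 'rV[R]_1) : pairing a x = a 0 0 * x 0 0 by rewrite /pairing big_ord1.
have sq (x : 'rV[R]_1) : segment_norm x = 1 -> x 0 0 * x 0 0 = 1.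
  by rewrite /segment_norm -expr2 -real_normK ?num_real // => ->; rewrite expr1n.
have normal x v : segment_norm x = 1 -> linear_near (@segment_norm R) x v -> v = x.
  move=> x1 /(linear_near_eq nS); rewrite x1 pE => E.
  apply/rowP => i; rewrite ord1; have := sq _ x1; nra.
have step i : [/\ p i.+1 = - q i, q i = p i & mu i = 2 /\ q i.+1 = - q i].
  have [v /(normal _ _ (q1 i)) -> pS] := bounce i.
  have [w /(normal _ _ (p1 i.+1)) -> qS] := flight i.
  have pS' := congr1 (fun x : 'rV_1 => x 0 0) pS.
  have qS' := congr1 (fun x : 'rV_1 => x 0 0) qS.
  have l0 := lam0 i; have m0 := mu0 i.
  have h1 := sq _ (q1 i); have h2 := sq _ (q1 i.+1).
  have h3 := sq _ (p1 i); have h4 := sq _ (p1 i.+1).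
  rewrite !mxE in pS' qS'.
  (* Squaring the bounce equation gives a quadratic equation in [lam i], with roots 0 and this
     value. *)
  have lE : lam i = 2 * (p i 0 0 * q i 0 0).
    have : lam i * (lam i - 2 * (p i 0 0 * q i 0 0)) = 0.
      have : (p i 0 0 - lam i * q i 0 0) * (p i 0 0 - lam i * q i 0 0) = 1 by rewrite -pS'.
      have h5 : lam i * lam i * (q i 0 0 * q i 0 0) = lam i * lam i by rewrite h1 mulr1.
      by lra.
    by move=> /eqP; rewrite mulf_eq0 (gt_eqF l0) subr_eq0 => /eqP.
  have pq1 : (p i 0 0 * q i 0 0) * (p i 0 0 * q i 0 0) = 1 by rewrite mulrACA h1 h3 mulr1.
  have pq : p i 0 0 * q i 0 0 = 1.
    move: lE l0 pq1; set s := p i 0 0 * q i 0 0 => -> s0 ss1.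
    have : (s - 1) * (s + 1) = 0 by rewrite -subr_sqr expr1n expr2 ss1 subrr.
    by move=> /eqP; rewrite mulf_eq0 => /orP[] /eqP; lra.
  have qp0 : q i 0 0 = p i 0 0.
    by rewrite -[LHS]mul1r -h3 -mulrA pq mulr1.
  have pS0 : p i.+1 0 0 = - q i 0 0 by rewrite pS' lE pq qp0; lra.
  have mE : mu i = 2.
    have : mu i * (mu i - 2) = 0.
      have : (q i 0 0 + mu i * p i.+1 0 0) * (q i 0 0 + mu i * p i.+1 0 0) = 1 by rewrite -qS'.
      have h5 : mu i * mu i * (q i 0 0 * q i 0 0) = mu i * mu i by rewrite h1 mulr1.
      have h6 : mu i * (q i 0 0 * q i 0 0) = mu i by rewrite h1 mulr1.
      by rewrite pS0; lra.
    by move=> /eqP; rewrite mulf_eq0 (gt_eqF m0) subr_eq0 => /eqP.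
  split; [| |split=> //]; apply/rowP => j; rewrite !ord1 ?mxE //.
  by rewrite qS' mE pS0; lra.
split.
  exists 0%N => i _; rewrite addn1 bounce_timeS.
  by have [pE' qE [-> ->]] := step i; split; rewrite ?pE' ?qE.
case=> [//|[|d]] i1 _ per; last by [].
have [E _] := per i1 (leqnn _); rewrite addn1 in E.
have [_ _ [_ E']] := step i1; rewrite E in E'.
have := sq _ (q1 i1); have := congr1 (fun x : 'rV_1 => x 0 0) E'; rewrite !mxE; nra.
Qed.

(* With Q_i = p_(i+1) and P_i = - q_i, bounces and flights exchange their roles. *)
Lemma trajectory_swap (R : realType) n (N M : 'rV[R]_n -> R) q p lam mu :
  polar_pair N M -> trajectory N M q p lam mu ->
  trajectory M N (fun i => p i.+1) (fun i => - q i) mu (fun i => lam i.+1).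
Proof.
move=> PP [lam0 mu0 q1 p1 bounce flight].
have nN := polar_pair_norm PP.
split=> // [i|i|i].
- by rewrite norm_opp.
- by have [w Hw ->] := flight i; exists w => //; rewrite opprD.
- have [v Hv ->] := bounce i.+1; exists (- v); first exact: linear_near_opp.
  by rewrite scalerN.
Qed.

(* Summation by parts. *)
Lemma trajectory_action (R : realType) n (N M : 'rV[R]_n -> R) q p lam mu i :
  polar_pair N M -> trajectory N M q p lam mu ->
  bounce_time lam i - bounce_time mu i = pairing (p 0%N) (q 0%N) - pairing (p i) (q i).
Proof.
move=> PP [lam0 mu0 q1 p1 bounce flight].
have nN := polar_pair_norm PP; have nM := polar_pair_dual PP.
elim: i => [|i IH]; first by rewrite /bounce_time !big_ord0 !subrr.
have [v /(linear_near_eq nN)] := bounce i; rewrite q1 => vE pS.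
have [w /(linear_near_eq nM)] := flight i; rewrite p1 => wE ->.
rewrite pairingDr pairingZr (pairingC (p i.+1) w) -wE {1}pS.
by rewrite pairingDl pairingNl pairingZl -vE !bounce_timeS; lra.
Qed.

Lemma rotates_swap (R : realType) n (N M : 'rV[R]_n -> R) :
  polar_pair N M -> rotates M N -> rotates N M.
Proof.
move=> PP rot q p lam mu tr.
have [[i0 half] per] := rot _ _ _ _ (trajectory_swap PP tr).
split.
  (* The exchange shifts the momenta by one: the sign change of [p i.+1] is read off at [i], that of
     [q i.+1] at [i.+1]. *)
  exists i0.+1 => -[//|i]; rewrite ltnS => i0i.
  have [pE qE tE] := half i i0i.
  have [_ qE' _] := half i.+1 (leqW i0i).
  have {}qE' : q (i.+1 + n)%N = - q i.+1 by apply: oppr_inj.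
  rewrite -!addSn in pE.
  split=> //.
  (* Both vectors change sign, so [pairing] takes the same value at both ends, and [lam] and [mu]
     have equal sums over the half period. *)
  have A1 := trajectory_action (i.+1 + n)%N PP tr.
  have A2 := trajectory_action i.+1 PP tr.
  have shift j : bounce_time (fun i => lam i.+1) j = bounce_time lam j.+1 - lam 0%N.
    by rewrite /bounce_time big_ord_recl addrC addKr.
  rewrite !shift -!addSn in tE.
  move: A1; rewrite qE' pE pairingNl pairingNr opprK; lra.
move=> d i1 d0 H; apply: (per d i1) => // i i1i.
have [-> _] := H i i1i.
by have [_] := H i.+1 (leqW i1i); rewrite addSn.
Qed.

(** * Counting and enumerating a subsequence of bounces *)

Definition bounces_before (S : pred nat) i := count S (iota 0 i).

Lemma bounces_beforeS S i : bounces_before S i.+1 = (bounces_before S i + S i)%N.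
Proof. by rewrite /bounces_before -addn1 iotaD count_cat /= addn0 add0n. Qed.

Lemma bounces_before_mono S i j : (i <= j)%N ->
  (bounces_before S i <= bounces_before S j)%N.
Proof.
move=> /subnKC <-; elim: (j - i)%N => [|e IH]; first by rewrite addn0.
by rewrite addnS bounces_beforeS (leq_trans IH) // leq_addr.
Qed.

Definition unbounded (S : pred nat) := forall i, exists j, (i <= j)%N && S j.

(** Here [sigma] lists [S] in increasing order and [nxt i] is the first element of [S] from [i] on;
    its rank is the number of elements of [S] below [i]. *)
Lemma unbounded_enum S : unbounded S -> exists sigma nxt : nat -> nat,
  [/\ forall i, (i <= nxt i)%N /\ forall l, (i <= l < nxt i)%N -> ~~ S l,
      forall j, sigma j.+1 = nxt (sigma j).+1,
      forall i, nxt i = sigma (bounces_before S i),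
      forall j, bounces_before S (sigma j) = j &
      forall j, S (sigma j)].
Proof.
move=> inf; pose nxt i := ex_minn (inf i).
pose sigma := fix f j := if j is j'.+1 then nxt (f j').+1 else nxt 0%N.
have nxtP i : [/\ (i <= nxt i)%N, S (nxt i) & forall l, (i <= l < nxt i)%N -> ~~ S l].
  rewrite /nxt; case: ex_minnP => j /andP[ij Sj] jmin; split=> // l /andP[il lj].
  by apply/negP => Sl; have := jmin l; rewrite il Sl leqNgt lj => /(_ isT).
have nxtS i : ~~ S i -> nxt i = nxt i.+1.
  move=> nS; have [a1 b1 c1] := nxtP i; have [a2 b2 c2] := nxtP i.+1.
  have ne : i <> nxt i by move=> E; move: nS; rewrite E b1.
  have [lt|lt|//] := ltngtP (nxt i) (nxt i.+1).
    by have := c2 (nxt i); rewrite lt b1 andbT => /(_ _)/implyP; lia.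
  by have := c1 (nxt i.+1); rewrite lt b2 andbT => /(_ _)/implyP; lia.
have nxtid i : S i -> nxt i = i.
  move=> Si; have [a1 b1 c1] := nxtP i.
  apply/eqP; rewrite eqn_leq a1 andbT leqNgt; apply/negP => lt.
  by have := c1 i; rewrite leqnn lt Si => /(_ isT).
have cn i : bounces_before S (nxt i) = bounces_before S i.
  have [a1 b1 c1] := nxtP i.
  rewrite -(subnKC a1); have : forall l, (i <= l < i + (nxt i - i))%N -> ~~ S l.
    by rewrite subnKC.
  elim: (nxt i - i)%N => [|e IH] H; first by rewrite addn0.
  rewrite addnS bounces_beforeS IH.
    by rewrite (negbTE (H _ _)) ?addn0 //; lia.
  by move=> l hl; apply: H; lia.
have sigmaP j : S (sigma j) by case: j => [|j]; [case: (nxtP 0%N) | case: (nxtP (sigma j).+1)].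
exists sigma, nxt; split=> //.
- by move=> i; have [a1 _ c1] := nxtP i.
- elim=> [//|i IH]; rewrite bounces_beforeS.
  case Si: (S i); last by rewrite addn0 -IH -nxtS ?Si.
  by rewrite addn1 /= -IH (nxtid i Si).
- elim=> [|j IH] /=; first by rewrite cn.
  rewrite cn bounces_beforeS IH.
  by rewrite sigmaP addn1.
Qed.

(** * Trajectories of an infinity-sum *)

(* A trajectory whose sequence of times is finer than its sequence of bounces:
   only the indices in S are bounces. *)
Record refined_trajectory (R : realType) n (N M : 'rV[R]_n -> R) (S : pred nat)
    (alpha : R) (x a : nat -> 'rV[R]_n) (lam mu : nat -> R) : Prop :=
  RefinedTrajectory {
  refined_alpha_gt0 : 0 < alpha;
  refined_lam_gt0 : forall i, 0 < lam i;
  refined_mu_gt0 : forall i, 0 < mu i;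
  refined_x_le1 : forall i, N (x i) <= 1;
  refined_a_norm : forall i, M (a i) = alpha;
  refined_bounce : forall i, S i -> N (x i) = 1 /\
    exists2 v, linear_near N (x i) v & a i.+1 = a i - lam i *: v;
  refined_idle : forall i, ~~ S i -> a i.+1 = a i;
  refined_flight : forall i,
    exists2 w, linear_near M (a i.+1) w & x i.+1 = x i + mu i *: w }.

Section RefinedTrajectory.
Variables (R : realType) (n : nat) (N M : 'rV[R]_n -> R) (S : pred nat) (alpha : R).
Variables (x a : nat -> 'rV[R]_n) (lam mu : nat -> R).
Hypothesis PP : polar_pair N M.
Hypothesis tr : refined_trajectory N M S alpha x a lam mu.

(** A momentum is known to be regular only from the flight made with it, and no flight is made with
    [a 0]. *)
Lemma refined_regular i : (0 < i)%N -> exists w, linear_near M (a i) w.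
Proof. by case: i => // i _; have [w Hw _] := refined_flight tr i; exists w. Qed.

(** Without bounces the momentum is constant, so by uniqueness of the normal all flights have the
    direction [w] and merge into one. *)
Lemma refined_free_flight i j w : (i <= j)%N ->
  (forall l, (i <= l < j)%N -> ~~ S l) ->
  linear_near M (a i) w ->
  a j = a i /\ x j = x i + (bounce_time mu j - bounce_time mu i) *: w.
Proof.
move=> /subnKC <-; elim: (j - i)%N => [|e IH] H Hw.
  by rewrite addn0 subrr scale0r addr0.
have [l hl|aE xE] := IH _ Hw; first by apply: H; lia.
have aS : a (i + e.+1)%N = a i.
  by rewrite addnS (refined_idle tr) //; apply: H; lia.
split=> //; have [w' Hw'] := refined_flight tr (i + e)%N.
rewrite -addnS aS in Hw' *.
rewrite (linear_near_unique (polar_pair_dual PP) Hw' Hw) xE => ->.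
by rewrite addnS bounce_timeS -addrA -scalerDl addrAC.
Qed.

Hypothesis Sinf : unbounded S.
Hypothesis rot : rotates N M.

(** Merging the flights between bounces in [S] and dividing the momenta by [alpha] gives a
    trajectory to which [rot] applies. Any other index lies on a segment ending at a bounce, and is
    negated with that segment. The second clause takes [i'] as given, because for an index outside
    [S] this factor alone does not supply it. *)
Lemma refined_half_period : exists i0,
  [/\ forall i, (i0 <= i)%N -> S i ->
        exists2 i', bounce_time mu i' = bounce_time mu i + 2 & S i',
      forall i i', (i0 <= i)%N -> bounce_time mu i' = bounce_time mu i + 2 ->
        [/\ x i' = - x i, a i' = - a i &
            bounces_before S i' = (bounces_before S i + n)%N] &
      forall d i1, (0 < d)%N -> periodic_from x a d i1 ->
        (forall i, (i1 <= i)%N -> S (i + d)%N = S i) ->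
        exists i2, forall i, (i2 <= i)%N ->
        (bounces_before S i + 2 * n <= bounces_before S (i + d))%N].
Proof.
have [sigma [nxt [nxtP sigmaS nxtE cnt Ssigma]]] := unbounded_enum Sinf.
have nM := polar_pair_dual PP.
have mu0 := refined_mu_gt0 tr.
have alpha0 := refined_alpha_gt0 tr.
have tlt := bounce_time_lt mu0; have tle := bounce_time_le mu0.
pose T := bounce_time mu.
have flight_nxt i w : linear_near M (a i) w ->
    a (nxt i) = a i /\ x (nxt i) = x i + (T (nxt i) - T i) *: w.
  by have [h1 h2] := nxtP i; exact: refined_free_flight.
have sigma_lt j : (sigma j < sigma j.+1)%N.
  by rewrite sigmaS; have [] := nxtP (sigma j).+1.
pose mu' j := T (sigma j.+1) - T (sigma j).
have tr' : trajectory N M (fun j => x (sigma j))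
    (fun j => alpha^-1 *: a (sigma j)) (fun j => alpha^-1 * lam (sigma j)) mu'.
  split=> [j|j|j|j|j|j].
  - by rewrite mulr_gt0 ?invr_gt0 // (refined_lam_gt0 tr).
  - by rewrite subr_gt0 tlt.
  - by have [] := refined_bounce tr (Ssigma j).
  - rewrite (normZ nM) (refined_a_norm tr) gtr0_norm ?invr_gt0 //.
    by rewrite mulVf ?gt_eqF.
  - have [_ [v Hv aE]] := refined_bounce tr (Ssigma j); exists v => //.
    have [w Hw] := refined_regular (ltn0Sn (sigma j)).
    have [aN _] := flight_nxt _ _ Hw; rewrite -sigmaS in aN.
    by rewrite aN aE scalerBr scalerA.
  - have [w Hw xE] := refined_flight tr (sigma j).
    have [aE' xE'] := flight_nxt _ _ Hw; rewrite -sigmaS in aE' xE'.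
    exists w; first by rewrite aE'; apply: linear_near_scale; rewrite ?invr_gt0.
    rewrite xE' xE -addrA -scalerDl /mu' /T bounce_timeS.
    by congr (_ + _ *: _); lra.
have mu'E j : bounce_time mu' j = T (sigma j) - T (sigma 0%N).
  elim: j => [|j IH]; first by rewrite /bounce_time big_ord0 subrr.
  by rewrite bounce_timeS IH /mu'; lra.
have [[j0 half] per] := rot tr'.
have {}half j : (j0 <= j)%N -> [/\ x (sigma (j + n)%N) = - x (sigma j),
    a (sigma (j + n)%N) = - a (sigma j) & T (sigma (j + n)%N) = T (sigma j) + 2].
  move=> /half[xE aE tE]; split=> //; last by rewrite !mu'E in tE; lra.
  rewrite -scalerN in aE.
  by apply: (scalerI _ aE); rewrite invr_eq0 gt_eqF.
(* Past bounce [j0] the count [c] of earlier bounces exceeds [j0], so [half] applies both to bounce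
   [c] and to bounce [c.-1]. *)
have cnt_ge i : ((sigma j0).+1 <= i)%N -> (j0.+1 <= bounces_before S i)%N.
  move=> /(bounces_before_mono S); rewrite bounces_beforeS cnt Ssigma; lia.
exists (sigma j0).+1; split.
- move=> i i0i Si; have [h1 h2] := nxtP i.
  have := cnt_ge _ i0i; set c := bounces_before S i => cj.
  have iE : i = sigma c.
    rewrite /c -nxtE; apply/eqP; rewrite eqn_leq h1 leqNgt /=.
    by apply/negP => lt; have := h2 i; rewrite leqnn lt Si => /(_ isT).
  have [_ _ E] := half c (ltnW cj).
  by exists (sigma (c + n)%N) => //; rewrite iE.
- move=> i i' i0i E.
  have := cnt_ge _ i0i; set c := bounces_before S i => cj.
  have sE : nxt i = sigma c by rewrite nxtE.
  have [xs as' ts] := half c (ltnW cj).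
  have [h1 h2] := nxtP i.
  (* Comparing times places [i'] after bounce [c.-1 + n] and not after bounce [c + n]. *)
  have i's' : (i' <= sigma (c + n)%N)%N.
    by rewrite -tle E -/T ts lerD2r tle -sE.
  have c0 : c = c.-1.+1 by lia.
  have [_ _ tp] : [/\ _, _ & _] := half c.-1 ltac:(lia).
  have lti' : (sigma (c.-1 + n)%N < i')%N.
    rewrite -tlt E -/T tp ltrD2r tlt ltnNge; apply/negP => le.
    by have := bounces_before_mono S le; rewrite cnt -/c; lia.
  have ci' : bounces_before S i' = (c + n)%N.
    apply/eqP; rewrite eqn_leq; apply/andP; split.
      by rewrite -[leqRHS](cnt (c + n)%N) bounces_before_mono.
    have := bounces_before_mono S lti'; rewrite bounces_beforeS cnt Ssigma; lia.
  have sE' : nxt i' = sigma (c + n)%N by rewrite nxtE ci'.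
  have [w Hw] := refined_regular (leq_trans (ltn0Sn _) i0i).
  have [aE xE] := flight_nxt _ _ Hw.
  have [w' Hw'] : exists w', linear_near M (a i') w'.
    by apply: refined_regular; lia.
  have [aE' xE'] := flight_nxt _ _ Hw'.
  have ai' : a i' = - a i by rewrite -aE' sE' as' -sE aE.
  split=> //.
  (* The segments through [i] and [i'] have opposite directions and reach opposite bounces after the
     same remaining time; tracing back from these ends gives the sign change of [x]. *)
  rewrite ai' in Hw'.
  have wE := linear_near_unique nM Hw' (linear_near_opp nM Hw).
  move: xE'; rewrite sE' xs ts -sE xE [T i'](E : _ = T i + 2) wE.
  have -> : T (nxt i) + 2 - (T i + 2) = T (nxt i) - T i by lra.
  by rewrite scalerN opprD => /addIr.
- move=> d i1 d0 perx perS.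
  (* The number of bounces in [S] during [d] steps is constant from [i1] on, and is a period of the
     merged trajectory, so [per] bounds it from below. *)
  pose e := (bounces_before S (i1 + d) - bounces_before S i1)%N.
  have eE i : (i1 <= i)%N -> bounces_before S (i + d)%N = (bounces_before S i + e)%N.
    move=> /subnKC <-; elim: (i - i1)%N => [|l IH].
      by rewrite addn0 subnKC // bounces_before_mono // leq_addr.
    by rewrite !addnS addSn !bounces_beforeS IH perS ?leq_addr // addnAC.
  have sige j : (i1 <= sigma j)%N -> sigma (j + e)%N = (sigma j + d)%N.
    move=> ij; have := eE _ ij; rewrite cnt => <-.
    have [h1 h2] := nxtP (sigma j + d)%N.
    rewrite -nxtE; apply/eqP; rewrite eqn_leq h1 andbT leqNgt.
    apply/negP => lt; have := h2 (sigma j + d)%N.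
    by rewrite leqnn lt perS // Ssigma => /(_ isT).
  have sigma_ge j : (j <= sigma j)%N.
    by elim: j => // j IH; apply: leq_ltn_trans IH (sigma_lt j).
  have e0 : (0 < e)%N.
    rewrite lt0n; apply/eqP => e0; have := sige i1 (sigma_ge i1).
    by rewrite e0 addn0; lia.
  have pe : periodic_from (fun j => x (sigma j)) (fun j => alpha^-1 *: a (sigma j)) e i1.
    move=> j ij; have ij' := leq_trans ij (sigma_ge j).
    by rewrite sige //; have [-> ->] := perx _ ij'.
  have := per _ _ e0 pe => le.
  by exists i1 => i /eE ->; rewrite leq_add2l.
Qed.

End RefinedTrajectory.

(** After the last bounce the point moves straight at unit speed inside the unit ball, whose
    diameter is 2. The extra index in [i1.+1] makes the momentum regular. *)
Lemma refined_time_bounded (R : realType) n (N M : 'rV[R]_n -> R) S alpha x a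
    lam mu i1 :
  polar_pair N M -> refined_trajectory N M S alpha x a lam mu ->
  (forall l, (i1 <= l)%N -> ~~ S l) ->
  exists B, forall i, bounce_time mu i <= B.
Proof.
move=> PP tr H; have nN := polar_pair_norm PP.
have tle := bounce_time_le (refined_mu_gt0 tr).
exists (bounce_time mu i1.+1 + 2) => i.
have [lt|le] := ltnP i i1.+1.
  by apply: (@le_trans _ _ (bounce_time mu i1.+1)); [rewrite tle ltnW | lra].
have [w Hw] := refined_regular tr (ltn0Sn i1).
have idle l : (i1.+1 <= l < i)%N -> ~~ S l by move=> hl; apply: H; lia.
have [_ xE] := refined_free_flight PP tr le idle Hw.
have := norm_triangle nN (x i) (- x i1.+1).
rewrite xE addrAC subrr add0r (normZ nN) (norm_opp nN).
rewrite (linear_near_dual_eq1 (polar_pairC PP) Hw) mulr1 -xE.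
rewrite ger0_norm ?subr_ge0 ?tle // => le2.
have := refined_x_le1 tr i; have := refined_x_le1 tr i1.+1; lra.
Qed.

(** Every late bounce is followed by another one exactly 2 later. *)
Lemma refined_time_unbounded (R : realType) n (N M : 'rV[R]_n -> R) S alpha x a
    lam mu :
  polar_pair N M -> refined_trajectory N M S alpha x a lam mu ->
  unbounded S -> rotates N M ->
  forall B, exists i, B < bounce_time mu i.
Proof.
move=> PP tr Sinf rot B; have [i0 [step _ _]] := refined_half_period PP tr Sinf rot.
have tlt := bounce_time_lt (refined_mu_gt0 tr).
have [s /andP[i0s Ss]] := Sinf i0.
have H r : exists i, [/\ (i0 <= i)%N, S i & r%:R <= bounce_time mu i].
  elim: r => [|r [i [i0i Si le]]].
    by exists s; split=> //; apply: sumr_ge0 => j _; apply/ltW/(refined_mu_gt0 tr).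
  have [i' E Si'] := step _ i0i Si; exists i'; split=> //.
    by apply: (leq_trans i0i); apply: ltnW; rewrite -tlt E ltrDl.
  by rewrite E -natr1; lra.
have [i [_ _ le]] := H (Num.bound `|B|); exists i; apply: lt_le_trans le.
exact: le_lt_trans (ler_norm B) (archi_boundP (normr_ge0 B)).
Qed.

Lemma not_unbounded S : ~ unbounded S ->
  exists i1, forall l, (i1 <= l)%N -> ~~ S l.
Proof.
move=> /existsNP[i1 H]; exists i1 => l il; apply/negP => Sl.
by apply: H; exists l; rewrite il.
Qed.

Lemma linear_near_max_r (R : realType) k l (N1 : 'rV[R]_k -> R)
    (N2 : 'rV[R]_l -> R) q v :
  is_norm N1 -> is_norm N2 -> linear_near (max_norm N1 N2) q v ->
  N1 (lsubmx q) < N2 (rsubmx q) ->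
  linear_near N2 (rsubmx q) (rsubmx v) /\ lsubmx v = 0.
Proof.
move=> n1 n2 [e e0 He] lt.
pose flip (z : 'rV[R]_(k + l)) := row_mx (rsubmx z) (lsubmx z).
have := @linear_near_max_l R l k N2 N1 (flip q) (flip v) n2 n1.
rewrite !row_mxKl !row_mxKr; apply=> //.
exists e => // h; rewrite -[h]hsubmxK max_normC_row => /He.
rewrite -[q in max_norm _ _ (q + _)]hsubmxK -[q in pairing _ (q + _)]hsubmxK.
rewrite -[v in pairing v _]hsubmxK !add_row_mx max_normC_row => ->.
by rewrite !pairing_row addrC.
Qed.

Lemma rotates_max (R : realType) k l (N1 M1 : 'rV[R]_k -> R)
    (N2 M2 : 'rV[R]_l -> R) :
  polar_pair N1 M1 -> polar_pair N2 M2 -> rotates N1 M1 -> rotates N2 M2 ->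
  rotates (max_norm N1 N2) (add_norm M1 M2).
Proof.
move=> P1 P2 R1 R2 q p lam mu [lam0 mu0 q1 p1 bounce flight].
have n1 := polar_pair_norm P1; have n2 := polar_pair_norm P2.
have m1 := polar_pair_dual P1; have m2 := polar_pair_dual P2.
pose x i := lsubmx (q i); pose y i := rsubmx (q i).
pose a i := lsubmx (p i); pose b i := rsubmx (p i).
pose S i := N2 (y i) < N1 (x i).
have qle i : N1 (x i) <= 1 /\ N2 (y i) <= 1.
  by have := q1 i; rewrite /max_norm => <-; rewrite !le_max !lexx orbT.
have bounceS i : S i -> [/\ N1 (x i) = 1,
    exists2 v, linear_near N1 (x i) v & a i.+1 = a i - lam i *: v
    & b i.+1 = b i].
  move=> Si; have [v Hv pE] := bounce i.
  have [Hv1 v2] := linear_near_max_l n1 n2 Hv Si.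
  split.
  - by rewrite -(q1 i) /max_norm max_l // ltW.
  - by exists (lsubmx v) => //; rewrite /a pE linearB linearZ.
  - by rewrite /b pE linearB linearZ /= v2 scaler0 subr0.
have bounceNS i : ~~ S i -> [/\ N2 (y i) = 1,
    exists2 v, linear_near N2 (y i) v & b i.+1 = b i - lam i *: v
    & a i.+1 = a i].
  rewrite /S -leNgt => Si; have [v Hv pE] := bounce i.
  (* A tie is excluded because the maximum is not linear near it, so outside [S] the second factor
     alone bounces. *)
  have {}Si : N1 (x i) < N2 (y i).
    by rewrite lt_neqAle Si andbT; apply/eqP; exact: (linear_near_max_neq P1 P2 Hv).
  have [Hv2 v1] := linear_near_max_r n1 n2 Hv Si.
  split.
  - by rewrite -(q1 i) /max_norm max_r // ltW.
  - by exists (rsubmx v) => //; rewrite /b pE linearB linearZ.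
  - by rewrite /a pE linearB linearZ /= v1 scaler0 subr0.
have ab i : M1 (a i) + M2 (b i) = 1 by rewrite -(p1 i).
have aconst i : M1 (a i) = M1 (a 0%N).
  elim: i => // i <-; case Si: (S i).
    by have [_ _ bE] := bounceS i Si; have := ab i; have := ab i.+1; rewrite bE; lra.
  by have [_ _ ->] := bounceNS i (negbT Si).
have bconst i : M2 (b i) = M2 (b 0%N).
  by have := ab i; have := ab 0%N; rewrite aconst; lra.
have flight12 i : (exists2 w, linear_near M1 (a i.+1) w & x i.+1 = x i + mu i *: w) /\
    (exists2 w, linear_near M2 (b i.+1) w & y i.+1 = y i + mu i *: w).
  have [w /(linear_near_add m1 m2)[Hw1 Hw2] qE] := flight i.
  split; [exists (lsubmx w) | exists (rsubmx w)] => //.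
    by rewrite /x qE linearD linearZ.
  by rewrite /y qE linearD linearZ.
have tr1 : refined_trajectory N1 M1 S (M1 (a 0%N)) x a lam mu.
  split=> // [|i|i Si|i Si|i].
  - have [[w Hw _] _] := flight12 0%N.
    by rewrite -(aconst 1%N); exact: linear_near_gt0 (polar_pairC P1) _ _ Hw.
  - by have [] := qle i.
  - by have [] := bounceS i Si.
  - by have [] := bounceNS i Si.
  - by have [] := flight12 i.
have tr2 : refined_trajectory N2 M2 (predC S) (M2 (b 0%N)) y b lam mu.
  split=> // [|i|i Si|i Si|i].
  - have [_ [w Hw _]] := flight12 0%N.
    by rewrite -(bconst 1%N); exact: linear_near_gt0 (polar_pairC P2) _ _ Hw.
  - by have [] := qle i.
  - by have [] := bounceNS i Si.
  - by rewrite /= negbK in Si; have [] := bounceS i Si.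
  - by have [] := flight12 i.
(* If the first factor stopped bouncing, the common flight time would be bounded; but the second
   factor would then bounce forever and make it unbounded. *)
have Sinf : unbounded S.
  apply: contrapT => /not_unbounded[i1 H].
  have nSinf : unbounded (predC S).
    by move=> i; exists (maxn i i1); rewrite leq_maxl /= H // leq_maxr.
  have [B leB] := refined_time_bounded P1 tr1 H.
  have [i] := refined_time_unbounded P2 tr2 nSinf R2 B.
  by rewrite ltNge leB.
have nSinf : unbounded (predC S).
  apply: contrapT => /not_unbounded[i1 H].
  have [B leB] := refined_time_bounded P2 tr2 H.
  have [i] := refined_time_unbounded P1 tr1 Sinf R1 B.
  by rewrite ltNge leB.
have cntE i : (bounces_before S i + bounces_before (predC S) i = i)%N.
  by rewrite /bounces_before count_predC size_iota.
have [i1 [next1 half1 per1]] := refined_half_period P1 tr1 Sinf R1.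
have [i2 [next2 half2 per2]] := refined_half_period P2 tr2 nSinf R2.
split.
  exists (maxn i1 i2) => i; rewrite geq_max => /andP[ge1 ge2].
  (* Whichever factor bounces at [i] supplies an index 2 units of time later, and [half1] and
     [half2] both apply to it. *)
  have [i' E] : exists i', bounce_time mu i' = bounce_time mu i + 2.
    case Si: (S i); first by have [i'] := next1 i ge1 Si; exists i'.
    by have [i'] := next2 i ge2 (negbT Si); exists i'.
  have [xE aE c1] := half1 _ _ ge1 E; have [yE bE c2] := half2 _ _ ge2 E.
  have i'E : i' = (i + (k + l))%N by rewrite -(cntE i') c1 c2 addnACA cntE.
  rewrite i'E in E xE aE yE bE; split=> //.
    by rewrite -[LHS]hsubmxK -[in RHS](hsubmxK (q i)) -/(x _) -/(y _) xE yE opp_row_mx.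
  by rewrite -[LHS]hsubmxK -[in RHS](hsubmxK (p i)) -/(a _) -/(b _) aE bE opp_row_mx.
move=> d j0 d0 per.
have perS i : (j0 <= i)%N -> S (i + d)%N = S i.
  by move=> /per[E _]; rewrite /S /x /y E.
have [j1 le1] : exists j1, forall i, (j1 <= i)%N ->
    (bounces_before S i + 2 * k <= bounces_before S (i + d))%N.
  by apply: (per1 d j0 d0 _ perS) => i /per[qE pE]; rewrite /x /a qE pE.
have [j2 le2] : exists j2, forall i, (j2 <= i)%N ->
    (bounces_before (predC S) i + 2 * l <= bounces_before (predC S) (i + d))%N.
  apply: (per2 d j0 d0) => [i /per[qE pE]|i /perS]; first by rewrite /y /b qE pE.
  by move=> /= ->.
have := le1 _ (leq_maxl j1 j2); have := le2 _ (leq_maxr j1 j2).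
have := cntE (maxn j1 j2); have := cntE (maxn j1 j2 + d)%N; lia.
Qed.

(** * Unit balls, facets and outer normals *)

Section UnitBall.
Variables (R : realType) (n : nat) (N : 'rV[R]_n -> R).
Hypothesis nN : is_norm N.

Lemma gauge_unit_ball : gauge [set x | N x <= 1] = N.
Proof.
apply/funext => x; rewrite /gauge.
have E r : 0 < r -> (N (r^-1 *: x) <= 1) = (N x <= r).
  move=> r0; rewrite (normZ nN) gtr0_norm ?invr_gt0 //.
  by rewrite mulrC ler_pdivrMr // mul1r.
set A := [set _ | _].
have memA e : 0 < e -> A (N x + e).
  have Nx := norm_ge0 nN x; move=> e0.
  by split; [|rewrite /= E]; lra.
have lbA : lbound A (N x) by move=> r [r0] /=; rewrite E.
apply/eqP; rewrite eq_le; apply/andP; split.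
  (* The value [N x] itself may be 0, which is not an admissible radius. *)
  apply/ler_addgt0Pr => e e0; apply: ge_inf; first by exists (N x).
  exact: memA.
by apply: lb_le_inf => //; exists (N x + 1); apply: memA.
Qed.

(** Row vectors carry the topology of their coordinates, while [linear_near] measures with [N]; this
    bound and [coord_le_norm] translate between the two. *)
Lemma norm_le_coord : exists2 C : R, 0 < C &
  forall (z : 'rV[R]_n) (d : R), 0 <= d -> (forall i, `|z 0 i| <= d) -> N z <= C * d.
Proof.
pose C := \sum_(i < n) N (delta_mx 0 i).
have C0 : 0 <= C by apply: sumr_ge0 => i _; apply: norm_ge0.
exists (C + 1) => [|z d d0 zd]; first by lra.
apply: (@le_trans _ _ (C * d)); last by rewrite ler_wpM2r //; lra.
rewrite [z]row_sum_delta mulr_suml.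
elim/big_ind2: _ => [|x1 x2 y1 y2 h1 h2|i _]; first by rewrite (norm_zero nN).
  by apply: (le_trans (norm_triangle nN _ _)); apply: lerD.
by rewrite (normZ nN) mulrC ler_wpM2l ?(norm_ge0 nN).
Qed.

(** Near [q] the gauge coincides with the linear form of [v], so the remainder in the definition of
    the differential vanishes there. *)
Lemma outer_normal_linear_near q v :
  linear_near N q v -> outer_normal [set x | N x <= 1] q = v.
Proof.
move=> Hv; apply/rowP => i; rewrite mxE gauge_unit_ball.
have pairing_linear : linear (pairing v : 'rV[R]_n -> R^o).
  by move=> t x y; rewrite pairingDr pairingZr.
pose gM := GRing.isLinear.Build _ _ _ _ _ pairing_linear.
pose g : {linear 'rV[R]_n -> R^o} := HB.pack (pairing v : 'rV[R]_n -> R^o) gM.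
have -> : 'd N q = g :> ('rV[R]_n -> R); last by rewrite /= pairing_delta.
apply: (@diff_unique R 'rV[R]_n R^o N g).
  move=> x; apply: (@cvg_big R^o _ +%R 0 _ _ _ (nbhs x)) => [|j _].
    exact: add_continuous.
  by apply: cvgM; [exact: cvg_cst | exact: coord_continuous].
apply/eqaddoP => e e0.
have NE := linear_near_eq nN Hv; case: Hv => d d0 Hd.
have [C C0 leC] := norm_le_coord.
apply/nbhs_ballP; exists (d / (2 * C)) => /= [|h [_ hd]].
  by rewrite divr_gt0 // mulr_gt0.
have Nh : N h < d.
  apply: (@le_lt_trans _ _ (C * (d / (2 * C)))).
    apply: leC => [|j]; first by rewrite divr_ge0 ?mulr_ge0 // ltW.
    by have := hd 0 j; rewrite /ball /= mxE sub0r normrN => /ltW.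
  have -> : C * (d / (2 * C)) = d / 2 by field; rewrite gt_eqF.
  by lra.
rewrite !fctE /= (addrC h q) Hd // pairingDr NE.
by rewrite [X in `|X|]subrr normr0 mulr_ge0 // ltW.
Qed.

End UnitBall.

Section PolarUnitBall.
Variables (R : realType) (n : nat) (N M : 'rV[R]_n -> R).
Hypothesis PP : polar_pair N M.

Lemma polar_unit_ball : polar [set x | N x <= 1] = [set p | M p <= 1].
Proof.
have nN := polar_pair_norm PP; have nM := polar_pair_dual PP.
apply/seteqP; split=> p /= H; first exact: (polar_pair_dual_le PP).
move=> x Nx; apply: (le_trans (polar_pair_holder PP p x)).
have := norm_ge0 nM p; have := norm_ge0 nN x; rewrite /= in Nx; nra.
Qed.

Lemma support_norm_polar x : support_norm [set p | M p <= 1] x = N x.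
Proof.
have nN := polar_pair_norm PP; have nM := polar_pair_dual PP.
have ub : ubound [set pairing p x | p in [set p | M p <= 1]] (N x).
  move=> _ [p /= Mp <-]; apply: (le_trans (polar_pair_holder PP p x)).
  have := norm_ge0 nM p; have := norm_ge0 nN x; nra.
apply/eqP; rewrite eq_le; apply/andP; split.
  apply: ge_sup ub; exists (pairing 0 x), 0 => //=.
  by rewrite (norm_zero nM) ler01.
apply: (polar_pair_norm_le PP) => p Mp; apply: ub_le_sup; first by exists (N x).
by exists p.
Qed.

Lemma coord_le_norm : exists2 C : R, 0 < C & forall (z : 'rV[R]_n) i, `|z 0 i| <= C * N z.
Proof.
have nN := polar_pair_norm PP; have nM := polar_pair_dual PP.
pose C := \sum_(i < n) M (delta_mx 0 i).
have C0 : 0 <= C by apply: sumr_ge0 => i _; apply: norm_ge0.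
exists (C + 1) => [|z i]; first by lra.
have Nz := norm_ge0 nN z.
apply: (@le_trans _ _ (M (delta_mx 0 i) * N z)).
  rewrite -(pairing_delta z i) pairingC ler_norml polar_pair_holder // andbT.
  rewrite lerNl -pairingNr.
  by apply: (le_trans (polar_pair_holder PP _ _)); rewrite (norm_opp nN).
apply: ler_wpM2r => //; rewrite /C (bigD1 i) //= -addrA lerDl.
by rewrite addr_ge0 // sumr_ge0 // => j _; apply: norm_ge0.
Qed.

(** By a dimension count the affine hull of the facet is the whole hyperplane where [pairing a]
    equals [c]. A point near [q] is projected radially to this hyperplane and lands in the ball,
    which bounds [N] by [a / c] there; the reverse bound holds everywhere. *)
Lemma facet_interior_linear_near q :
  in_facet_interior [set x | N x <= 1] q ->
  N q = 1 /\ exists v, linear_near N q v.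
Proof.
have nN := polar_pair_norm PP; have n0 := polar_pair_dim PP.
set K := [set x | _].
move=> [F [[a [c [ac FE]]] [x0 [B [Bfree hullE]]]] [Fq nearq]].
have sub_hull y : F y -> (y - x0 <= B)%MS.
  move=> Fy; have : affine_hull F y.
    by exists 1%N, (fun=> 1), (fun=> y); split; rewrite ?big_ord1 ?scale1r.
  by rewrite hullE.
have rB : \rank B = n.-1 by apply/eqP.
have aq : pairing a q = c by move: Fq; rewrite FE => -[].
have K0 : K 0 by rewrite /K /= (norm_zero nN) ler01.
(* For [a = 0] the face would be the whole ball, whose hull has dimension [n] instead of [n.-1]. *)
have a0 : a <> 0.
  move=> a0; have c0 : c = 0 by rewrite -aq a0 pairing0l.
  have FK y : K y -> F y by rewrite FE => Ky; split=> //=; rewrite a0 pairing0l.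
  have x0B : (x0 <= B)%MS.
    have := sub_hull _ (FK _ K0); rewrite sub0r -scaleN1r => /(scalemx_sub (-1)).
    by rewrite scalerA mulN1r opprK scale1r.
  have full : (1%:M <= B)%MS.
    apply/row_subP => i.
    have [t t0 tlt] := norm_scale_lt nN (row i 1%:M) ltr01.
    have := sub_hull _ (FK (t *: row i 1%:M) (ltW tlt)).
    move=> /(addmx_sub x0B); rewrite addrC subrK => /(scalemx_sub t^-1).
    by rewrite scalerA mulVf ?gt_eqF // scale1r.
  by have := mxrankS full; rewrite mxrank1 rB; case: (n) n0 => //= n' _; rewrite ltnn.
have aa : 0 < pairing a a.
  rewrite lt0r; apply/andP; split; first by apply/eqP => /pairing_self_eq0.
  by apply: sumr_ge0 => i _; rewrite -expr2 sqr_ge0.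
have c0 : 0 < c.
  have [t t0 tlt] := norm_scale_lt nN a ltr01.
  by have := ac _ (ltW tlt); rewrite pairingZr; apply: lt_le_trans; rewrite mulr_gt0.
have hull_sub y : (y - x0 <= B)%MS -> pairing a y = c.
  move=> By; have : affine_hull F y by rewrite hullE.
  move=> [k [s [w [Fw s1 ->]]]].
  rewrite (_ : pairing a _ = \sum_(i < k) s i * c); first by rewrite -mulr_suml s1 mul1r.
  elim/big_ind2: _ => [|x1 x2 y1 y2 <- <-|i _]; rewrite ?pairing0r ?pairingDr //.
  by rewrite pairingZr; have := Fw i; rewrite FE => -[_ /= ->].
have pairing_mx (y : 'rV[R]_n) : y *m a^T = (pairing a y)%:M.
  apply/rowP => j; rewrite ord1 !mxE eqxx mulr1n.
  by apply: eq_bigr => i _; rewrite mxE mulrC.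
have ax0 : pairing a x0 = c by apply: hull_sub; rewrite subrr sub0mx.
(* The row space of [B] lies in the kernel of [a], and both have rank [n.-1]. *)
have kerB : (kermx a^T <= B)%MS.
  have Bker : (B <= kermx a^T)%MS.
    apply/row_subP => i; apply/sub_kermxP; rewrite pairing_mx.
    have := hull_sub (x0 + row i B); rewrite addrAC subrr add0r row_sub => /(_ isT).
    by rewrite pairingDr ax0 -[X in _ = X]addr0 => /addrI ->; rewrite raddf0.
  have [_] := mxrank_leqif_sup Bker; rewrite rB mxrank_ker mxrank_tr rank_rV.
  have -> : a != 0 by apply/eqP.
  by rewrite subn1 eqxx => /esym.
have plane y : pairing a y = c -> affine_hull F y.
  move=> ay; rewrite hullE /=; apply: submx_trans kerB.
  by apply/sub_kermxP; rewrite pairing_mx pairingDr pairingNr ay ax0 subrr raddf0.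
pose v := c^-1 *: a.
have vE y : pairing v y = pairing a y / c by rewrite pairingZl mulrC.
have vle y : pairing v y <= N y.
  apply: (le_trans (polar_pair_holder PP _ _)).
  rewrite -[X in _ <= X]mul1r ler_wpM2r ?(norm_ge0 nN) //.
  apply: (polar_pair_dual_le PP) => z Kz.
  by rewrite vE ler_pdivrMr // mul1r; exact: ac.
have vq : pairing v q = 1 by rewrite vE aq divff // gt_eqF.
have [d d0 Hd] : exists2 d : R, 0 < d &
    forall y, (forall i, `|(y - q) 0 i| < d) -> pairing a y = c -> N y <= 1.
  case/nbhs_ballP: nearq => d /= d0 H; exists d => // y yq ay.
  have : F y.
    apply: H (plane _ ay); split=> // i j; rewrite ord1 /ball /=.
    by have := yq j; rewrite !mxE distrC.
  by rewrite FE => -[].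
have [C C0 leC] := coord_le_norm.
have Nq1 : N q <= 1 by move: Fq; rewrite FE => -[].
have Hv : linear_near N q v.
  (* The bound 1/2 gives [s > 1/2]; the projection then moves [q] by at most [4 * N h] in the norm,
     hence each coordinate by less than [d]. *)
  exists (Num.min (1 / 2) (d / (4 * C))).
    by rewrite lt_min !divr_gt0 // mulr_gt0.
  move=> h; rewrite lt_min => /andP[h1 h2].
  have vh1 := vle h; have := vle (- h); rewrite pairingNr (norm_opp nN) => vh2.
  have sE : pairing v (q + h) = 1 + pairing v h by rewrite pairingDr vq.
  set s := pairing v (q + h) in sE *.
  have s0 : 1 / 2 < s by lra.
  apply/eqP; rewrite eq_le vle andbT.
  have s00 : 0 < s by lra.
  have : N (s^-1 *: (q + h)) <= 1.
    apply: Hd => [i|].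
      apply: (le_lt_trans (leC _ _)).
      have -> : s^-1 *: (q + h) - q = s^-1 *: (h - pairing v h *: q).
        apply: (scalerI (lt0r_neq0 s00)); rewrite scalerBr !scalerA divff ?lt0r_neq0 //.
        by rewrite !scale1r sE scalerDl scale1r opprD addrA (addrC q h) addrK.
      rewrite (normZ nN) gtr0_norm ?invr_gt0 // mulrCA mulrC ltr_pdivrMr //.
      have := norm_triangle nN h (- (pairing v h *: q)).
      rewrite (norm_opp nN) (normZ nN) => tri.
      have vh : `|pairing v h| <= N h by rewrite ler_norml vh1 andbT lerNl.
      have {}tri : N (h - pairing v h *: q) <= 2 * N h.
        apply: (le_trans tri); have := norm_ge0 nN q; have := norm_ge0 nN h.
        by have := normr_ge0 (pairing v h); nra.
      have h3 : N h * (4 * C) < d by rewrite -ltr_pdivlMr // mulr_gt0.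
      nra.
    have sa : s = pairing a (q + h) / c by rewrite /s vE.
    have sa' : pairing a (q + h) = s * c by rewrite sa divfK // gt_eqF.
    by rewrite pairingZr sa' mulrA mulVf ?gt_eqF // mul1r.
  by rewrite (normZ nN) gtr0_norm ?invr_gt0 // mulrC ler_pdivrMr // mul1r.
by split; [rewrite (linear_near_eq nN Hv) | exists v].
Qed.

End PolarUnitBall.

Lemma hanner_norms (R : realType) n (H : set 'rV[R]_n) : hanner H ->
  exists N M, [/\ polar_pair N M, rotates N M & H = [set x | N x <= 1]].
Proof.
elim=> {n H} [|k l K L _ [N1 [M1 [P1 R1 KE]]] _ [N2 [M2 [P2 R2 LE]]]
  |k l K L _ [N1 [M1 [P1 R1 KE]]] _ [N2 [M2 [P2 R2 LE]]]].
- exists (@segment_norm R), (@segment_norm R); split.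
  + exact: polar_pair_segment.
  + exact: rotates_segment.
  + by apply/seteqP; split=> x /=; rewrite /segment_norm ler_norml.
- have PP := polar_pair_add P1 P2.
  exists (add_norm N1 N2), (max_norm M1 M2); split=> //.
    (* Both factors are exchanged with their polars, [rotates_max] is applied to these, and the
       result is exchanged back. *)
    apply: (rotates_swap PP); apply: rotates_max; try exact: polar_pairC.
      exact: rotates_swap (polar_pairC P1) R1.
    exact: rotates_swap (polar_pairC P2) R2.
  rewrite /sum_one KE LE (gauge_unit_ball (polar_pair_norm P1)).
  by rewrite (gauge_unit_ball (polar_pair_norm P2)).
- have PP := polar_pair_add (polar_pairC P1) (polar_pairC P2).
  exists (max_norm N1 N2), (add_norm M1 M2); split.
  + exact: polar_pairC.
  + exact: rotates_max.
  rewrite /sum_infty KE LE (gauge_unit_ball (polar_pair_norm P1)).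
  by rewrite (gauge_unit_ball (polar_pair_norm P2)).
Qed.

(** * Closed trajectories *)

Lemma periodic_mul (T : Type) (f : nat -> T) d :
  (forall i, f (i + d)%N = f i) -> forall c i, f (i + c * d)%N = f i.
Proof.
move=> fd; elim=> [|c IH] i; first by rewrite addn0.
by rewrite mulSn addnA IH fd.
Qed.

Lemma periodic_gcdn (T : Type) (f : nat -> T) d e : (0 < d)%N ->
  (forall i, f (i + d)%N = f i) -> (forall i, f (i + e)%N = f i) ->
  forall i, f (i + gcdn d e)%N = f i.
Proof.
(* The Bezout identity is taken in the form [kd * d = ke * e + gcdn d e], free of subtraction. *)
move=> d0 fd fe i; case: (egcdnP e d0) => kd ke E _.
by rewrite -(periodic_mul fe ke) -addnA [(gcdn d e + _)%N]addnC -E periodic_mul.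
Qed.

Lemma periodic_modn (T : Type) (f : nat -> T) d :
  (forall i, f (i + d)%N = f i) -> forall i j, i = j %[mod d] -> f i = f j.
Proof.
move=> fd i j ij.
by rewrite (divn_eq i d) (divn_eq j d) ij !(addnC (_ * d)%N) !periodic_mul.
Qed.

Theorem theorem3p4 (R : realType) (n : nat) (H : set 'rV[R]_n)
    (hH : hanner H) (m : nat) (q p : 'I_m -> 'rV[R]_n)
    (htraj : billiard_trajectory H (polar H) q p)
    (hsimple : simple_trajectory q p) :
  [/\ length_wrt (support_norm (polar H)) q = 4 /\ length_wrt (gauge H) q = 4,
      m = (2 * n)%N &
      forall i j : 'I_m, (j = i + n %[mod 2 * n])%N ->
        q j = - q i /\ p j = - p i].
Proof.
have [N [M [PP rot HE]]] := hanner_norms hH.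
have nN := polar_pair_norm PP; have nM := polar_pair_dual PP.
have n0 := polar_pair_dim PP.
move: htraj; rewrite HE (polar_unit_ball PP) => -[m0 qK pT bounce flight].
have [lam lamP] := choice (fun i => let: ex_intro2 l l0 E := bounce i in
  ex_intro _ l (conj l0 E)).
have [mu muP] := choice (fun i => let: ex_intro2 l l0 E := flight i in
  ex_intro _ l (conj l0 E)).
(* The cyclic sequences are unrolled to sequences over nat of period [m]. *)
pose ix i : 'I_m := Ordinal (ltn_pmod i m0).
have ixS i : ix i.+1 = ordS (ix i).
  by apply: val_inj; rewrite /= -(addn1 (i %% m)) modnDml addn1.
have ixD i : ix (i + m)%N = ix i by apply: val_inj; rewrite /= modnDr.
have ixE (i : 'I_m) : ix i = i by apply: val_inj; rewrite /= modn_small.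
pose Q i := q (ix i); pose P i := p (ix i); pose mu' i := mu (ix i).
have QD i : Q (i + m)%N = Q i by rewrite /Q ixD.
have PD i : P (i + m)%N = P i by rewrite /P ixD.
have flightN i : exists2 w, linear_near M (p (ordS i)) w &
    q (ordS i) = q i + mu i *: w.
  have [_ [w Hw]] := facet_interior_linear_near (polar_pairC PP) (pT (ordS i)).
  exists w => //; have [_] := muP i.
  by rewrite (outer_normal_linear_near nM Hw) => <-; rewrite addrC subrK.
have tr : trajectory N M Q P (fun i => lam (ix i)) mu'.
  split=> [i|i|i|i|i|i].
  - by have [] := lamP (ix i).
  - by have [] := muP (ix i).
  - by have [] := facet_interior_linear_near PP (qK (ix i)).
  - by have [] := facet_interior_linear_near (polar_pairC PP) (pT (ix i)).
  - have [_ [v Hv]] := facet_interior_linear_near PP (qK (ix i)).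
    exists v => //; have [_] := lamP (ix i); rewrite /P ixS.
    by rewrite (outer_normal_linear_near nN Hv) => <-; rewrite addrC subrK.
  - by rewrite /P /Q ixS; exact: flightN.
have [[i0 half] per] := rot _ _ _ _ tr.
have sym i : Q (i + n)%N = - Q i /\ P (i + n)%N = - P i.
  (* Adding a multiple of [m] moves any index past [i0] without changing the point. *)
  pose j := (i + i0 * m)%N; have ij : (i0 <= j)%N.
    by rewrite /j (leq_trans _ (leq_addl _ _)) // leq_pmulr.
  have [qE pE _] := half j ij.
  have ixj : ix j = ix i by apply: periodic_mul ixD _ _.
  have ixjn : ix (j + n)%N = ix (i + n)%N.
    by rewrite /j addnAC; apply: periodic_mul ixD _ _.
  by rewrite /Q /P ixj ixjn in qE pE.
have Q2 i : Q (i + 2 * n)%N = Q i.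
  by rewrite mul2n -addnn addnA (sym (i + n)%N).1 (sym i).1 opprK.
have P2 i : P (i + 2 * n)%N = P i.
  by rewrite mul2n -addnn addnA (sym (i + n)%N).2 (sym i).2 opprK.
(* Both [m] and [2 * n] are periods, hence so is their gcd, which [per] bounds below by [2 * n]. *)
have dvd_m : (2 * n %| m)%N.
  have g0 : (0 < gcdn m (2 * n))%N by rewrite gcdn_gt0 m0.
  have perg : periodic_from Q P (gcdn m (2 * n)) 0.
    by move=> i _; split; apply: periodic_gcdn.
  apply/gcdn_idPr/eqP; rewrite eqn_leq (per _ _ g0 perg) andbT.
  by rewrite dvdn_leq ?dvdn_gcdr // muln_gt0.
have mE : m = (2 * n)%N.
  case/dvdnP: dvd_m => c mE.
  (* A quotient 0 contradicts [m0], and a quotient above 1 contradicts simplicity. *)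
  have [c1|c1] := leqP c 1.
    by case: c c1 mE => [|[|c]] // _ E; [have := m0; rewrite E | rewrite mul1n in E].
  case: hsimple; exists c, (2 * n)%N; split=> // i j ij.
  by rewrite -(ixE i) -(ixE j); split;
    [exact: (periodic_modn Q2 ij) | exact: (periodic_modn P2 ij)].
have len : length_wrt N q = 4.
  have -> : length_wrt N q = bounce_time mu' m.
    apply: eq_bigr => i _; rewrite /mu' ixE.
    have [w Hw ->] := flightN i; rewrite addrAC subrr add0r (normZ nN).
    rewrite (linear_near_dual_eq1 (polar_pairC PP) Hw) mulr1 gtr0_norm //.
    by have [] := muP i.
  have shift j : bounce_time mu' (j + m) = bounce_time mu' j + bounce_time mu' m.
    elim: j => [|j IH]; first by rewrite /bounce_time big_ord0 add0r.
    by rewrite addSn !bounce_timeS IH /mu' ixD addrAC.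
  (* Two half periods starting at [i0] take time 2 each, and by [shift] the total time over [m]
     steps does not depend on the start. *)
  have [_ _ t1] := half i0 (leqnn _); have [_ _ t2] := half (i0 + n)%N (leq_addr _ _).
  by have := shift i0; rewrite {1}mE mul2n -addnn addnA t2 t1; lra.
split=> //.
  rewrite gauge_unit_ball //.
  by split=> //; rewrite (_ : support_norm _ = N) //; apply/funext; exact: support_norm_polar.
move=> i j ij; rewrite -(ixE i) -(ixE j).
have [E1 E2] := sym i; split.
  by rewrite -[q (ix j)]/(Q j) (periodic_modn Q2 ij).
by rewrite -[p (ix j)]/(P j) (periodic_modn P2 ij).
Qed.
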